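(* Let $p\geq 3$ be a prime and let $G_p$ be the Gupta-Sidki $p$-group. Then there are infinitely many Nielsen equivalence classes on generating pairs of $G_p$; that is, the action of $\operatorname{Aut} F_2$ on the set $\{(g_1,g_2)\in G_p\times G_p \mid \langle g_1,g_2\rangle=G_p\}$ has infinitely many orbits.
   Context: Rooted tree. For a prime $p\ge 3$ let $X=\{1,2,\dots,p\}$. The regular $p$-ary rooted tree $T_p$ has as vertices all finite sequences over $X$; two sequences are joined by an edge when one is obtained from the other by appending one letter on the right; the root is the empty sequence. $\operatorname{Aut} T_p$ is the group of bijections of the vertex set preserving the root and adjacency. Gupta-Sidki $p$-group. Let $\pi=(1,2,\dots,p)$ be the cyclic permutation of $X$. Define $x,y\in\operatorname{Aut} T_p$ (both fix the root) by, for $s\in X$ and $\sigma$ a vertex of $T_p$: $x(s\sigma)=\pi(s)\sigma$, and, recursively, $y(s\sigma)=s\,x(\sigma)$ if $s=1$, $y(s\sigma)=s\,x^{-1}(\sigma)$ if $s=2$, $y(s\sigma)=s\,y(\sigma)$ if $s=p$, and $y(s\sigma)=s\sigma$ otherwise. The Gupta-Sidki $p$-group is $G_p=\langle x,y\rangle\le\operatorname{Aut} T_p$. Nielsen equivalence. For a group $G$ generated by $k$ elements, let $\operatorname{Epi}(F_k,G)$ be the set of epimorphisms from the free group $F_k$ of rank $k$ onto $G$; it is identified with the set of generating $k$-tuples $(g_1,\dots,g_k)$ of $G$ via the images of a fixed basis of $F_k$. The group $\operatorname{Aut} F_k$ acts on $\operatorname{Epi}(F_k,G)$ by $\phi^{\tau}=\phi\circ\tau^{-1}$.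 The orbits are called Nielsen (equivalence) classes on generating $k$-tuples of $G$. Equivalently, two generating $k$-tuples are Nielsen equivalent if one is obtained from the other by a finite sequence of elementary Nielsen moves: replacing $g_i$ by $g_i g_j^{\pm1}$ for some $i\ne j$, or replacing some $g_j$ by $g_j^{-1}$ (all other entries unchanged). *)

(* Defs.v *)
From HB Require Import structures.
From mathcomp Require Import all_boot.
From mathcomp Require Import boolp classical_sets functions cardinality.

Set Implicit Arguments.
Unset Strict Implicit.
Unset Printing Implicit Defensive.

Local Open Scope classical_set_scope.
Local Open Scope group_scope.

(* The letters 1, ..., p are the ordinals 0, ..., p - 1; the letter s is the
   ordinal of value s - 1. *)
Definition vertex (p : nat) := seq 'I_p.

Definition adjacent (p : nat) (u v : vertex p) : Prop :=
  (exists s, v = rcons u s) \/ (exists s, u = rcons v s).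

(* Bijectivity is recorded by a two-sided inverse, which is unique, so that two
   automorphisms with the same underlying function are equal (tree_aut_eq). *)
Record tree_aut (p : nat) := TreeAut {
  tree_aut_fun :> vertex p -> vertex p;
  tree_aut_inv : vertex p -> vertex p;
  tree_autK : cancel tree_aut_fun tree_aut_inv;
  tree_autVK : cancel tree_aut_inv tree_aut_fun;
  tree_aut_root : tree_aut_fun [::] = [::];
  tree_aut_adj : forall u v,
    adjacent (tree_aut_fun u) (tree_aut_fun v) <-> adjacent u v
}.

Lemma tree_aut_eq (p : nat) (f g : tree_aut p) : f =1 g -> f = g.
Proof.
case: f g => [f f' fK f'K f0 fa] [g g' gK g'K g0 ga] /= /funext fg.
subst g; have f'g' : f' = g'.
  by apply/funext => v; rewrite -{1}[v]g'K fK.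
subst g'; congr TreeAut; exact: Prop_irrelevance.
Qed.

HB.instance Definition _ (p : nat) := gen_eqMixin (tree_aut p).
HB.instance Definition _ (p : nat) := gen_choiceMixin (tree_aut p).

Section TreeAutGroup.
Variable p : nat.
Implicit Types f g h : tree_aut p.

Definition tree_aut_one : tree_aut p :=
  @TreeAut p id id (fun=> erefl) (fun=> erefl) erefl (fun _ _ => iff_refl _).

Lemma tree_aut_mul_root f g : f (g [::]) = [::].
Proof. by rewrite !tree_aut_root. Qed.

Lemma tree_aut_mul_adj f g u v :
  adjacent (f (g u)) (f (g v)) <-> adjacent u v.
Proof. by split=> [/tree_aut_adj/tree_aut_adj|?]//; do 2!apply/tree_aut_adj. Qed.

(* (f * g) v = f (g v) *)
Definition tree_aut_mul f g : tree_aut p :=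
  TreeAut (can_comp (@tree_autK _ f) (@tree_autK _ g))
    (can_comp (@tree_autVK _ g) (@tree_autVK _ f))
    (tree_aut_mul_root f g) (tree_aut_mul_adj f g).

Lemma tree_aut_inv_root f : tree_aut_inv f [::] = [::].
Proof. by rewrite -{1}(tree_aut_root f) tree_autK. Qed.

Lemma tree_aut_inv_adj f u v :
  adjacent (tree_aut_inv f u) (tree_aut_inv f v) <-> adjacent u v.
Proof. by rewrite -(tree_aut_adj f) !tree_autVK. Qed.

Definition tree_aut_invg f : tree_aut p :=
  TreeAut (@tree_autVK _ f) (@tree_autK _ f)
    (tree_aut_inv_root f) (tree_aut_inv_adj f).

Lemma tree_aut_mulA : associative tree_aut_mul.
Proof. by move=> f g h; apply: tree_aut_eq. Qed.

Lemma tree_aut_mul1 : left_id tree_aut_one tree_aut_mul.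
Proof. by move=> f; apply: tree_aut_eq. Qed.

Lemma tree_aut_mulr1 : right_id tree_aut_one tree_aut_mul.
Proof. by move=> f; apply: tree_aut_eq. Qed.

Lemma tree_aut_mulV : left_inverse tree_aut_one tree_aut_invg tree_aut_mul.
Proof. by move=> f; apply: tree_aut_eq => v /=; rewrite tree_autK. Qed.

Lemma tree_aut_mulrV : right_inverse tree_aut_one tree_aut_invg tree_aut_mul.
Proof. by move=> f; apply: tree_aut_eq => v /=; rewrite tree_autVK. Qed.

HB.instance Definition _ := isGroup.Build (tree_aut p)
  tree_aut_mulA tree_aut_mul1 tree_aut_mulr1 tree_aut_mulV tree_aut_mulrV.

End TreeAutGroup.

Definition is_subgroup (G : groupType) (H : set G) : Prop :=
  H 1 /\ forall u v, H u -> H v -> H (u / v).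

Definition generated (G : groupType) (S : set G) : set G :=
  smallest (@is_subgroup G) S.

Section GuptaSidki.
Variable p : nat.

(* ordS is the p-cycle (1, 2, ..., p) on letters, and ord_pred its inverse. *)
Definition gs_x_fun (w : vertex p) : vertex p :=
  if w is s :: v then ordS s :: v else [::].

Definition gs_xV_fun (w : vertex p) : vertex p :=
  if w is s :: v then ord_pred s :: v else [::].

Fixpoint gs_y_fun (w : vertex p) : vertex p :=
  if w is s :: v then
    s :: (if s == 0%N :> nat then gs_x_fun v
          else if s == 1%N :> nat then gs_xV_fun v
          else if s == p.-1%N :> nat then gs_y_fun v
          else v)
  else [::].

Fixpoint gs_yV_fun (w : vertex p) : vertex p :=
  if w is s :: v then
    s :: (if s == 0%N :> nat then gs_xV_fun v
          else if s == 1%N :> nat then gs_x_fun v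
          else if s == p.-1%N :> nat then gs_yV_fun v
          else v)
  else [::].

Lemma gs_x_funK : cancel gs_x_fun gs_xV_fun.
Proof. by case=> //= s v; rewrite ordSK. Qed.

Lemma gs_xV_funK : cancel gs_xV_fun gs_x_fun.
Proof. by case=> //= s v; rewrite ord_predK. Qed.

Lemma gs_y_funK : cancel gs_y_fun gs_yV_fun.
Proof.
elim=> //= s v IHv; congr cons.
case: (_ == 0)%N; rewrite ?gs_x_funK ?gs_xV_funK//.
case: (_ == 1)%N; rewrite ?gs_x_funK ?gs_xV_funK//.
by case: (_ == p.-1).
Qed.

Lemma gs_yV_funK : cancel gs_yV_fun gs_y_fun.
Proof.
elim=> //= s v IHv; congr cons.
case: (_ == 0)%N; rewrite ?gs_x_funK ?gs_xV_funK//.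
case: (_ == 1)%N; rewrite ?gs_x_funK ?gs_xV_funK//.
by case: (_ == p.-1).
Qed.

Lemma gs_x_fun_rcons u s : exists t, gs_x_fun (rcons u s) = rcons (gs_x_fun u) t.
Proof. by case: u => [|r u] /=; [exists (ordS s) | exists s]. Qed.

Lemma gs_xV_fun_rcons u s :
  exists t, gs_xV_fun (rcons u s) = rcons (gs_xV_fun u) t.
Proof. by case: u => [|r u] /=; [exists (ord_pred s) | exists s]. Qed.

Lemma gs_y_fun_rcons u s : exists t, gs_y_fun (rcons u s) = rcons (gs_y_fun u) t.
Proof.
elim: u => [|r u [t IHu]] /=; first by exists s; do 3?case: ifP.
have [a xa] := gs_x_fun_rcons u s; have [b xb] := gs_xV_fun_rcons u s.
do 3?case: ifP => _; [exists a|exists b|exists t|exists s] => //;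
  by rewrite ?xa ?xb ?IHu.
Qed.

Lemma gs_yV_fun_rcons u s :
  exists t, gs_yV_fun (rcons u s) = rcons (gs_yV_fun u) t.
Proof.
elim: u => [|r u [t IHu]] /=; first by exists s; do 3?case: ifP.
have [a xa] := gs_x_fun_rcons u s; have [b xb] := gs_xV_fun_rcons u s.
do 3?case: ifP => _; [exists b|exists a|exists t|exists s] => //;
  by rewrite ?xa ?xb ?IHu.
Qed.

Lemma adjacent_of_rcons (f g : vertex p -> vertex p) :
    cancel f g ->
    (forall u s, exists t, f (rcons u s) = rcons (f u) t) ->
    (forall u s, exists t, g (rcons u s) = rcons (g u) t) ->
  forall u v, adjacent (f u) (f v) <-> adjacent u v.
Proof.
have half (h : vertex p -> vertex p) : (forall u s, exists t, h (rcons u s) = rcons (h u) t) ->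
    forall u v : vertex p, adjacent u v -> adjacent (h u) (h v).
  by move=> hr u v [] [s ->]; [left|right]; apply: hr.
move=> fK fr gr u v; split; last exact: half.
by move=> /(half _ gr); rewrite !fK.
Qed.

Definition gs_x : tree_aut p :=
  TreeAut gs_x_funK gs_xV_funK erefl
    (adjacent_of_rcons gs_x_funK gs_x_fun_rcons gs_xV_fun_rcons).

Definition gs_y : tree_aut p :=
  TreeAut gs_y_funK gs_yV_funK erefl
    (adjacent_of_rcons gs_y_funK gs_y_fun_rcons gs_yV_fun_rcons).

Definition gupta_sidki : set (tree_aut p) := generated [set gs_x; gs_y].

End GuptaSidki.

(* The letter (i, false) is the i-th basis element, (i, true) its inverse. *)
Definition letter (k : nat) := ('I_k * bool)%type.

Definition letter_inv (k : nat) (l : letter k) : letter k := (l.1, ~~ l.2).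

Definition reduced (k : nat) (w : seq (letter k)) : bool :=
  sorted (fun l m => m != letter_inv l) w.

Record free_group (k : nat) := FreeGroup {
  free_word :> seq (letter k);
  free_wordP : reduced free_word
}.

HB.instance Definition _ (k : nat) := [isSub for @free_word k].
HB.instance Definition _ (k : nat) := [Choice of free_group k by <:].

Section FreeGroup.
Variable k : nat.
Implicit Types (l m : letter k) (u v w : seq (letter k)) (a b : free_group k).

Definition free_cons l w : seq (letter k) :=
  if w is m :: v then if m == letter_inv l then v else l :: w else [:: l].

Lemma letter_invK : involutive (@letter_inv k).
Proof. by case=> i b; rewrite /letter_inv /= negbK. Qed.

Lemma letter_inv_neq l : letter_inv l != l.
Proof. by case: l => i []; rewrite xpair_eqE andbF. Qed.

Lemma free_cons_reduced l w : reduced w -> reduced (free_cons l w).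
Proof.
case: w => //= m w; case: eqP => [_|/eqP ml] /=; first exact: path_sorted.
by rewrite /reduced /= ml.
Qed.

Lemma free_cons_id l w : reduced (l :: w) -> free_cons l w = l :: w.
Proof. by case: w => //= m w /andP[/negPf->]. Qed.

Lemma free_consK l w :
  reduced w -> free_cons (letter_inv l) (free_cons l w) = w.
Proof.
case: w => [_|m w rw] /=; first by rewrite letter_invK eqxx.
case: eqP rw => [->|_] rw; first exact: free_cons_id.
by rewrite /= letter_invK eqxx.
Qed.

Definition free_cat u v : seq (letter k) := foldr free_cons v u.

Lemma free_cat_reduced u v : reduced v -> reduced (free_cat u v).
Proof. by move=> rv; elim: u => //= l u; apply: free_cons_reduced. Qed.

Lemma free_cat_cons l v w : reduced v -> reduced w ->
  free_cat (free_cons l v) w = free_cons l (free_cat v w).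
Proof.
case: v => //= m v _ rw; case: eqP => //= ->.
by rewrite -{1}[l]letter_invK free_consK// free_cat_reduced.
Qed.

Lemma free_cats0 u : reduced u -> free_cat u [::] = u.
Proof.
elim: u => //= l u IHu rlu.
by rewrite IHu ?free_cons_id//; apply: (path_sorted rlu).
Qed.

Definition free_rev u : seq (letter k) := rev (map (@letter_inv k) u).

Lemma free_rev_reduced u : reduced u -> reduced (free_rev u).
Proof.
rewrite /reduced /free_rev rev_sorted sorted_map.
apply: sub_sorted => l m /=; apply: contra => /eqP->.
by rewrite letter_invK.
Qed.

Lemma free_revK : involutive free_rev.
Proof.
by move=> u; rewrite /free_rev map_rev revK -map_comp map_id_in// => l _ /=;
  rewrite letter_invK.
Qed.

Lemma free_cat_rev u w :
  reduced w -> free_cat (free_rev u) (free_cat u w) = w.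
Proof.
move=> rw; elim: u => //= l u IHu.
rewrite /free_rev /= rev_cons {1}/free_cat foldr_rcons free_consK//.
exact: free_cat_reduced.
Qed.

Definition free_one : free_group k := FreeGroup (isT : reduced [::]).

Definition free_mul a b : free_group k :=
  FreeGroup (free_cat_reduced a (free_wordP b)).

Definition free_inv a : free_group k := FreeGroup (free_rev_reduced (free_wordP a)).

Definition free_gen (i : 'I_k) : free_group k :=
  FreeGroup (isT : reduced [:: (i, false)]).

Lemma free_mulA : associative free_mul.
Proof.
move=> a b c; apply/val_inj => /=; elim: (free_word a) => //= l w ->.
by rewrite free_cat_cons ?free_cat_reduced ?free_wordP.
Qed.

Lemma free_mul1 : left_id free_one free_mul.
Proof. by move=> a; apply/val_inj. Qed.

Lemma free_mulr1 : right_id free_one free_mul.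
Proof. by move=> a; apply/val_inj/free_cats0/free_wordP. Qed.

Lemma free_mulV : left_inverse free_one free_inv free_mul.
Proof.
move=> a; apply/val_inj => /=.
by rewrite -{2}(free_cats0 (free_wordP a)) free_cat_rev.
Qed.

Lemma free_mulrV : right_inverse free_one free_inv free_mul.
Proof.
move=> a; have /= := free_mulV (free_inv a).
by congr (free_mul _ _ = _); apply/val_inj/free_revK.
Qed.

HB.instance Definition _ := isGroup.Build (free_group k)
  free_mulA free_mul1 free_mulr1 free_mulV free_mulrV.

End FreeGroup.

Definition letter_eval (G : groupType) (k : nat) (g : 'I_k -> G) (l : letter k) : G :=
  if l.2 then (g l.1)^-1 else g l.1.

(* The morphism F_k -> G sending the i-th basis element to g i; see
   free_lift_gen, free_liftM and free_lift_unique. *)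
Definition free_lift (G : groupType) (k : nat) (g : 'I_k -> G)
    (a : free_group k) : G :=
  \prod_(l <- free_word a) letter_eval g l.

Section FreeLift.
Variables (G : groupType) (k : nat) (g : 'I_k -> G).

Lemma free_lift_gen i : free_lift g (free_gen i) = g i.
Proof. by rewrite /free_lift big_seq1. Qed.

Lemma free_liftM : {morph free_lift g : a b / a * b}.
Proof.
move=> a b; rewrite /free_lift /=; elim: (free_word a) => [|l w IHw] /=.
  by rewrite big_nil mul1g.
rewrite big_cons -mulgA -IHw; case: (free_cat w b) => [|m v] /=.
  by rewrite big_seq1 big_nil mulg1.
case: eqP => [->|_]; last by rewrite !big_cons.
rewrite big_cons mulgA /letter_eval /=.
by case: l.2 => /=; rewrite ?mulVg ?mulgV mul1g.
Qed.

Lemma free_lift_unique (h : free_group k -> G) :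
  {morph h : a b / a * b} -> (forall i, h (free_gen i) = g i) ->
  h =1 free_lift g.
Proof.
move=> hM hg [w rw]; elim: w rw => [|l w IHw] rlw.
  rewrite /free_lift big_nil; apply: (@mulgI _ (h (FreeGroup rlw))).
  by rewrite -hM mulg1; congr h; apply/val_inj.
have rw : reduced w := path_sorted rlw.
have rl : reduced [:: l] by [].
have -> : FreeGroup rlw = FreeGroup rl * FreeGroup rw.
  by apply/val_inj; rewrite /= free_cons_id.
rewrite hM free_liftM IHw; congr (_ * _).
have h1 : h 1 = 1 by apply: (@mulgI _ (h 1)); rewrite -hM !mulg1.
rewrite {1}/free_lift big_seq1 /letter_eval.
case: l rl {rlw} => i [] rl /=; last by rewrite -hg; congr h; apply/val_inj.
apply: (@mulIg _ (g i)); rewrite mulVg -{1}hg -hM -h1; congr h.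
by apply/val_inj; rewrite /= /letter_inv /= eqxx.
Qed.

End FreeLift.

Record group_aut (G : groupType) := GroupAut {
  group_aut_fun :> G -> G;
  group_aut_inv : G -> G;
  group_autM : {morph group_aut_fun : a b / a * b};
  group_autK : cancel group_aut_fun group_aut_inv;
  group_autVK : cancel group_aut_inv group_aut_fun
}.

Section Nielsen.
Variables (G : groupType) (k : nat).

Definition generating_tuples (H : set G) : set ('I_k -> G) :=
  [set g | generated (range g) = H].

(* With phi = free_lift g, this is the tuple of the images of the basis under
   phi \o tau^-1. *)
Definition nielsen_act (tau : group_aut (free_group k)) (g : 'I_k -> G) :
    'I_k -> G :=
  fun i => free_lift g (group_aut_inv tau (free_gen i)).

Definition nielsen_class (g : 'I_k -> G) : set ('I_k -> G) :=
  [set nielsen_act tau g | tau in setT].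

Definition nielsen_classes (H : set G) : set (set ('I_k -> G)) :=
  [set nielsen_class g | g in generating_tuples H].

Lemma nielsen_act_lift tau g :
  free_lift (nielsen_act tau g) =1 free_lift g \o group_aut_inv tau.
Proof.
apply/fsym/free_lift_unique => // a b /=.
rewrite -free_liftM; congr free_lift.
by apply: (can_inj (group_autK tau)); rewrite group_autM !group_autVK.
Qed.

End Nielsen.

(* Main.v *)
Require Import Defs.
From mathcomp Require Import all_boot zify.
From mathcomp Require Import boolp classical_sets functions cardinality.

Set Implicit Arguments.
Unset Strict Implicit.
Unset Printing Implicit Defensive.

Local Open Scope classical_set_scope.
Local Open Scope group_scope.

(** A Nielsen move on a pair (g, h) changes the commutator [~ g, h] only by
conjugation and inversion.  The automorphism group of a free group of rank two
is generated by such moves, so the commutator, up to conjugacy and inversion,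
is an invariant of the Nielsen class of a pair ([nielsen_class_commutator]). It
remains to find generating pairs of the Gupta-Sidki group G whose commutators
fall into infinitely many classes.

Write (g_1, ..., g_p) for the automorphism that fixes every letter s and acts
as g_s below it.  Then y = (x, x^-1, 1, ..., 1, y), and conjugation by x
rotates such a vector.  Let D be the derived subgroup of G, let (u, v) be a
generating pair of G with u = x and v = y modulo D and v ^ p = 1, and let d in
D commute with u.  Then x * (1, d, 1, ..., 1) and (u, u^-1, 1, ..., 1, v) again
generate G ([twisted_pair_generates]).  Indeed, let L be the subgroup that they
generate.  Rotating the second generator by the first and taking commutators
gives elements of L supported below a single letter.  The sections of such
elements form a subgroup normalised by u and v, and [~ u, v] belongs to it,
hence it contains D.  So L contains every element of D placed below any one
letter, and these elements correct the two generators to x and y.  The case u =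
x, v = y, d = 1 shows at the same time that G contains the elements used here.

This construction is applied twice.  Put c = [~ x, y] and let d_n be obtained
from c by n applications of g |-> (g, ..., g); for n > 0 it commutes with x.
From the pair (x, y) and d = d_(n+1) one gets that x_n = x * (1, d, 1, ..., 1)
and y generate G, with x_n ^ p = (d, ..., d).  From the pair (x_n, y) and d = 1
one gets that x and y_n = (x_n, x_n^-1, 1, ..., 1, y) generate G.  The section
of [~ x, y_n] below the first letter is x_n ^ 2, so that of its p-th power is c
^ 2 pushed down n + 2 levels.  As c ^ 2 fixes the first level but not the
second, this section fixes level n + 3 but not level n + 4.  The set of
integers m for which some first-level section fixes level m but not level m + 1
is finite, and invariant under conjugation and inversion ([depths]).  Finitely
many Nielsen classes would leave only finitely many such integers, whereas
every n + 3 occurs ([depth_deep_commutator]). *)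

(** * Subgroups, derived subgroups and normalizers *)

Section Subgroups.
Variable G : groupType.
Implicit Types (H K S : set G) (g h t u v : G).

Lemma subgroupV H g : is_subgroup H -> H g -> H g^-1.
Proof. by case=> H1 HF Hg; rewrite -[g^-1]mul1g; apply: HF. Qed.

Lemma subgroupM H g h : is_subgroup H -> H g -> H h -> H (g * h).
Proof.
by move=> sH Hg Hh; rewrite -[h]invgK; apply: sH.2 => //; apply: subgroupV.
Qed.

Lemma subgroupJ H g h : is_subgroup H -> H g -> H h -> H (g ^ h).
Proof.
move=> sH Hg Hh; apply: subgroupM => //; first exact: subgroupV.
exact: subgroupM.
Qed.

Lemma subgroupR H g h : is_subgroup H -> H g -> H h -> H [~ g, h].
Proof.
by move=> sH Hg Hh; apply: subgroupM => //; [apply: subgroupV|apply: subgroupJ].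
Qed.

Lemma generated_subgroup S : is_subgroup (generated S).
Proof.
split=> [H [[]]//|u v Su Sv H HS].
by apply: HS.1.2; [apply: Su|apply: Sv].
Qed.

Lemma sub_generated S : S `<=` generated S.
Proof. exact: sub_smallest. Qed.

Lemma generated_min H S : is_subgroup H -> S `<=` H -> generated S `<=` H.
Proof. exact: smallest_sub. Qed.

Lemma generated2_min H u v : is_subgroup H -> H u -> H v ->
  generated [set u; v] `<=` H.
Proof. by move=> sH Hu Hv; apply: generated_min => // _ [->|->]. Qed.

Lemma mem_gen2l u v : generated [set u; v] u.
Proof. by apply: sub_generated; left. Qed.

Lemma mem_gen2r u v : generated [set u; v] v.
Proof. by apply: sub_generated; right. Qed.

Lemma generated2_sub u v u' v' :
  generated [set u'; v'] u -> generated [set u'; v'] v ->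
  generated [set u; v] `<=` generated [set u'; v'].
Proof. exact: (generated2_min (generated_subgroup _)). Qed.

Definition derived H : set G :=
  generated [set g | exists a b, [/\ H a, H b & g = [~ a, b]]].

Lemma derived_subgroup H : is_subgroup (derived H).
Proof. exact: generated_subgroup. Qed.

Lemma mem_derived H g h : H g -> H h -> derived H [~ g, h].
Proof. by move=> Hg Hh; apply: sub_generated; exists g, h. Qed.

Lemma derived_sub H : is_subgroup H -> derived H `<=` H.
Proof.
move=> sH; apply: generated_min => [|_ [a [b [Ha Hb ->]]]] //.
exact: subgroupR.
Qed.

(** Stated as an equivalence, so that normalizing elements form a subgroup for
every subset K. *)
Definition normalizer K : set G := [set t | forall g, K (g ^ t) <-> K g].

Lemma normalizer_subgroup K : is_subgroup (normalizer K).
Proof.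
split=> [g|u v Nu Nv g]; first by rewrite conjg1.
by rewrite conjgM -(Nv (_ ^ _)) conjgKV Nu.
Qed.

Lemma derived_normal H : is_subgroup H -> H `<=` normalizer (derived H).
Proof.
move=> sH.
have dJ t g : H t -> derived H g -> derived H (g ^ t).
  move=> Ht dg; rewrite -[_ ^ _](mulVKg g) -commgEl.
  apply: (subgroupM (derived_subgroup H)) => //.
  by apply: mem_derived => //; apply: (derived_sub sH).
move=> t Ht g; split; last exact: dJ.
by move=> /(dJ t^-1); rewrite conjgK; apply; apply: subgroupV.
Qed.

(** The identity [~ g, h * k] = [~ g, k] * [~ g, h] ^ k makes this set stable
under products once K is normalized by k. *)
Lemma commutator_subgroup K g : is_subgroup K ->
  is_subgroup [set h | normalizer K h /\ K [~ g, h]].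
Proof.
move=> sK; have sN := normalizer_subgroup K; split=> [|h k [Nh Kh] [Nk Kk]].
  by split; [exact: sN.1|rewrite commg1; apply: sK.1].
have NVk := subgroupV sN Nk; split; first exact: sN.2.
have cM a b : [~ g, a * b] = [~ g, b] * [~ g, a] ^ b.
  by rewrite !commgEl conjgM (conjMg g^-1) conjVg -mulgA mulVKg.
have cV : [~ g, k^-1] = ([~ g, k] ^ k^-1)^-1.
  by apply/eqP; rewrite -mulg_eq1 -cM mulgV commg1.
rewrite cM cV; apply: subgroupM => //; last exact/NVk.
by apply: subgroupV => //; apply/NVk.
Qed.

(** The elements commuting with u and v modulo K form a subgroup by the previous
lemma, applied in each of the two arguments of the commutator in turn. *)
Lemma derived_gen2_sub K u v : is_subgroup K ->
    normalizer K u -> normalizer K v -> K [~ u, v] ->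
  derived (generated [set u; v]) `<=` K.
Proof.
move=> sK Nu Nv Kuv.
have Kvu : K [~ v, u] by rewrite -invgR; apply: subgroupV.
have gen g : K [~ g, u] -> K [~ g, v] ->
    forall h, generated [set u; v] h -> K [~ g, h].
  move=> Kgu Kgv h /(generated2_min (commutator_subgroup g sK)).
  by move=> /(_ (conj Nu Kgu) (conj Nv Kgv))[].
have K1 g : K [~ g, g] by rewrite commgg; apply: sK.1.
apply: generated_min => // _ [a [b [Ha Hb ->]]].
have genV g : K [~ g, u] -> K [~ g, v] -> K [~ a, g].
  by move=> Kgu Kgv; rewrite -invgR; apply: subgroupV => //; apply: gen Ha.
by apply: gen Hb; apply: genV.
Qed.

End Subgroups.

(** * Length and common prefixes in a free group *)

Fixpoint lcp (T : eqType) (s t : seq T) : nat :=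
  if s is a :: s' then
    if t is b :: t' then if a == b then (lcp s' t').+1 else 0 else 0
  else 0.

Section CommonPrefix.
Variable T : eqType.
Implicit Types s t r : seq T.

Lemma lcpC s t : lcp s t = lcp t s.
Proof. by elim: s t => [|a s IHs] [|b t] //=; rewrite IHs eq_sym. Qed.

Lemma lcp_lel s t : lcp s t <= size s.
Proof.
by elim: s t => [|a s IHs] [|b t] //=; case: eqP => // _; apply: IHs.
Qed.

Lemma lcp_ultrametric s t r : minn (lcp s t) (lcp t r) <= lcp s r.
Proof.
elim: s t r => [|a s IHs] [|b t] [|c r] //=; rewrite ?min0n ?minn0//.
case: (eqVneq a b) => [->|_]; last by rewrite min0n.
case: (eqVneq b c) => [_|_]; rewrite ?minn0// minnSS ltnS; exact: IHs.
Qed.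

Lemma lcp_take s n : n <= size s -> lcp (take n s) s = n.
Proof. by elim: n s => [|n IHn] [|a s] //=; rewrite eqxx ltnS => /IHn->. Qed.

Lemma nth_lcp x0 s t i : i < lcp s t -> nth x0 s i = nth x0 t i.
Proof.
elim: s t i => [|a s IHs] [|b t] [|i] //=; case: eqP => // _.
by rewrite ltnS => /IHs.
Qed.

End CommonPrefix.

Section FreeLength.
Variable k : nat.
Notation F := (free_group k).
Implicit Types (g h : F) (u v : seq (letter k)).

Lemma free_cat_reducedE u v : reduced (u ++ v) -> free_cat u v = u ++ v.
Proof.
elim: u => //= l u IHu ruv; rewrite IHu ?free_cons_id//.
exact: path_sorted ruv.
Qed.

(** The product of the inverse of u by v cancels exactly the common prefix of u
and v: the letters that follow it are different, so no further cancellation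
occurs. *)
Lemma size_free_cat_rev u v : reduced u -> reduced v ->
  size (free_cat (free_rev u) v) + (lcp u v).*2 = size u + size v.
Proof.
elim: u v => [|l u IHu] v ru rv /=.
  by rewrite addn0.
case: v rv => [|m v] rv.
  by rewrite free_cats0 ?free_rev_reduced// !addn0 /free_rev size_rev size_map.
case: eqP => [lm|/eqP lm].
  rewrite -lm in rv *.
  have [ru' rv'] := (path_sorted ru : reduced u, path_sorted rv : reduced v).
  rewrite /free_rev /= rev_cons /free_cat foldr_rcons /= eq_sym letter_invK.
  rewrite eqxx.
  by have := IHu v ru' rv'; rewrite /free_rev /free_cat; lia.
rewrite free_cat_reducedE.
  by rewrite size_cat /free_rev size_rev size_map /= addn0.
rewrite /reduced /free_rev /= rev_cons cat_rcons.
have := free_rev_reduced ru; rewrite /reduced /free_rev /= rev_cons.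
rewrite sorted_cat_cons => -> /=; rewrite letter_invK eq_sym lm /=.
exact: rv.
Qed.

Definition free_len g : nat := size (free_word g).
Definition free_lcp g h : nat := lcp (free_word g) (free_word h).

Lemma free_len_lcp g h :
  free_len (g^-1 * h) + (free_lcp g h).*2 = free_len g + free_len h.
Proof. exact: size_free_cat_rev (free_wordP g) (free_wordP h). Qed.

Lemma free_len_eq0 g : free_len g = 0 -> g = 1.
Proof. by case: g => [[|l w] rw] //= _; apply: val_inj. Qed.

Lemma free_lenV g : free_len g^-1 = free_len g.
Proof. by rewrite /free_len /= size_rev size_map. Qed.

Lemma free_lcpC g h : free_lcp g h = free_lcp h g.
Proof. exact: lcpC. Qed.

Lemma free_lcp_ultrametric f g h :
  minn (free_lcp f g) (free_lcp g h) <= free_lcp f h.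
Proof. exact: lcp_ultrametric. Qed.

Lemma free_prefix g n : n <= free_len g ->
  exists2 q, free_len q = n & free_lcp q g = n.
Proof.
move=> le_n; have rq : reduced (take n (free_word g)).
  have := free_wordP g; rewrite -{1}(cat_take_drop n (free_word g)) /reduced.
  by case/cat_sorted2.
exists (FreeGroup rq); last exact: lcp_take.
exact: size_takel.
Qed.

(** If half of g cancelled in g * g, then g would read the same as its formal
inverse from its ends up to its middle.  At the middle this makes either one
letter its own inverse or two neighbouring letters inverse to each other. *)
Lemma free_lcp_self g : g != 1 -> (free_lcp g^-1 g).*2 < free_len g.
Proof.
move=> g1; rewrite ltnNge; apply: contra g1 => le_g; apply/eqP/free_len_eq0.
case: g le_g => w rw; rewrite /free_lcp /free_len /= => le_w.
case: (posnP (size w)) => // w_gt0; exfalso.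
case: w rw w_gt0 le_w => // l0 w'; set w := l0 :: w' => rw w_gt0 le_w.
have mirror i : i < lcp (free_rev w) w ->
    letter_inv (nth l0 w (size w - i.+1)) = nth l0 w i.
  move=> lt_i; have lt_iw : i < size w.
    by apply: leq_trans lt_i _; rewrite lcpC lcp_lel.
  rewrite -(nth_lcp l0 lt_i) /free_rev nth_rev size_map//.
  by rewrite (nth_map l0)//; lia.
have eq_w := odd_double_half (size w).
case: (boolP (odd (size w))) eq_w => [_|_] eq_w.
  have /mirror : (size w)./2 < lcp (free_rev w) w by lia.
  have -> : size w - (size w)./2.+1 = (size w)./2 by lia.
  by apply/eqP; rewrite letter_inv_neq.
have m_lt : (size w)./2.-1 < lcp (free_rev w) w by lia.
have := mirror _ m_lt.
have -> : size w - (size w)./2.-1.+1 = (size w)./2 by lia.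
move=> /(congr1 (@letter_inv k)); rewrite letter_invK.
have /(sortedP l0)/(_ (size w)./2.-1) := rw.
have -> : (size w)./2.-1.+1 = (size w)./2 by lia.
have -> : (size w)./2 < size w by lia.
by move=> /(_ isT)/eqP.
Qed.

End FreeLength.

Section FreeLengthProduct.
Variable k : nat.
Notation F := (free_group k).
Implicit Types (g h : F).

Lemma free_lenM g h :
  free_len (g * h) + (free_lcp g^-1 h).*2 = free_len g + free_len h.
Proof. by have := free_len_lcp g^-1 h; rewrite invgK free_lenV. Qed.

(** The letters of g that survive in g * h form the common prefix of the two. *)
Lemma free_lcpMl g h : free_lcp (g * h) g + free_lcp g^-1 h = free_len g.
Proof.
have := free_len_lcp (g * h) g; rewrite invgM mulgVK free_lenV.
by have := free_lenM g h; lia.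
Qed.

Lemma free_lcp_ler g h : free_lcp g h <= free_len h.
Proof. by rewrite free_lcpC; apply: lcp_lel. Qed.

Lemma free_lcp_isosceles f g h :
  free_lcp g h < free_lcp f g -> free_lcp f h = free_lcp g h.
Proof.
move=> lt_gh; have := free_lcp_ultrametric g f h.
by have := free_lcp_ultrametric f g h; rewrite (free_lcpC g f); lia.
Qed.

Lemma letter_eval_inv (G : groupType) (f : 'I_k -> G) l :
  letter_eval f (letter_inv l) = (letter_eval f l)^-1.
Proof. by case: l => i []; rewrite /letter_eval //= invgK. Qed.

End FreeLengthProduct.

(** * Nielsen reduction in rank two *)

(** In a product of three consecutive factors e l, e m, e n, the cancellations
on the two sides of e m leave at least one of its letters. *)
Definition nielsen_reduced (k j : nat) (f : 'I_k -> free_group j) : Prop :=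
  forall l m n : letter k, m != letter_inv l -> n != letter_inv m ->
    let e : letter k -> free_group j := letter_eval f in
    free_lcp (e l)^-1 (e m) + free_lcp (e m)^-1 (e n) < free_len (e m).

(** At least one letter of each factor survives in the product.  When the
product W * e m of the factors read so far is multiplied by e l, the part of e
m left in W * e m is longer than what e l cancels from e m alone, so e l
cancels exactly as much from W * e m as it does from e m. *)
Lemma nielsen_reduced_len k j (f : 'I_k -> free_group j) :
  nielsen_reduced f ->
  forall w : free_group k, free_len w <= free_len (free_lift f w).
Proof.
move=> fN; pose e : letter k -> free_group j := letter_eval f.
pose c (W : free_group j) l := free_lcp W^-1 (e l).
pose prod w : free_group j := \prod_(m <- w) e m.
have prodS w m : prod (rcons w m) = prod w * e m.
  by rewrite /prod -cats1 big_cat big_seq1.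
have step w l : reduced (rcons w l) ->
    let W := prod w in
    (forall n, n != letter_inv l ->
       c W l + free_lcp (e l)^-1 (e n) < free_len (e l)) /\
    size w + free_len (e l) <= free_len (W * e l) + c W l.
  elim/last_ind: w l => [|w m IHw] l rw.
    rewrite /prod /= big_nil mul1g /c invg1.
    split=> [n nl|]; last exact: leq_addr.
    apply: leq_ltn_trans (fN l l n _ nl); first by rewrite leq_add2r.
    by rewrite eq_sym letter_inv_neq.
  have [rm lm] : reduced (rcons w m) /\ l != letter_inv m.
    move: rw; rewrite /reduced -cats1 cat_rcons sorted_cat_cons /= andbT.
    by case/andP.
  have [lt_m le_m] := IHw m rm.
  rewrite prodS size_rcons /=.
  set W := prod w in lt_m le_m *.
  have cE : c (W * e m) l = free_lcp (e m)^-1 (e l).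
    apply: free_lcp_isosceles; rewrite invgM.
    have := free_lcpMl (e m)^-1 W^-1.
    rewrite invgK free_lenV free_lcpC (free_lcpC (e m)).
    by have := lt_m l lm; rewrite /c; lia.
  rewrite cE; split=> [n nl|]; first exact: fN.
  have := free_lenM (W * e m) (e l); rewrite -/(c _ _) cE /=.
  by have := lt_m l lm; lia.
case=> w rw; case: (lastP w) rw => [|w' l] rw //.
have [lt_l] := step w' l rw.
have /lt_l : l != letter_inv l by rewrite eq_sym letter_inv_neq.
have -> : free_lift f (FreeGroup rw) = prod w' * e l.
  exact: prodS.
have -> : free_len (FreeGroup rw) = (size w').+1 by apply: size_rcons.
by rewrite -/(c _ _); lia.
Qed.

Definition conj_pm (G : groupType) (g h : G) : Prop :=
  exists t, g = h ^ t \/ g = (h^-1) ^ t.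

Section ConjPm.
Variable G : groupType.
Implicit Types g h t u v : G.

Lemma conj_pmV g : conj_pm g^-1 g.
Proof. by exists 1; right; rewrite conjg1. Qed.

Lemma conj_pm_sym g h : conj_pm g h -> conj_pm h g.
Proof.
by case=> t [] ->; exists t^-1; [left|right]; rewrite ?conjVg ?invgK conjgK.
Qed.

Lemma conj_pm_trans g h t : conj_pm g h -> conj_pm h t -> conj_pm g t.
Proof.
move=> [a ga] [b hb]; exists (b * a); case: ga hb => -> [] ->;
  rewrite ?conjVg ?invgK -conjgM; by [left|right].
Qed.

Lemma conj_pm_commgC u v : conj_pm [~ v, u] [~ u, v].
Proof. by rewrite -invgR; apply: conj_pmV. Qed.

Lemma conj_pm_commgV u v : conj_pm [~ u^-1, v] [~ u, v].
Proof.
exists u^-1; right.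
by rewrite /commg /conjg !invgM !invgK !mulgA mulgK.
Qed.

Lemma conj_pm_commg_mulr u v : conj_pm [~ u * v, v] [~ u, v].
Proof.
by exists v; left; rewrite /commg /conjg !invgM !mulgA.
Qed.

End ConjPm.

Section RankTwo.
Notation F := (free_group 2).

Let i0 : 'I_2 := ord0.
Let i1 : 'I_2 := ord_max.

Lemma generated_lift (G : groupType) k (f : 'I_k -> G) g :
  generated (range f) g -> exists w : free_group k, free_lift f w = g.
Proof.
have lift1 : free_lift f 1 = 1 by rewrite /free_lift big_nil.
pose S := [set h | exists w, free_lift f w = h].
apply: (@generated_min _ S) => [|_ [i _ <-]].
  2: by exists (free_gen i); rewrite free_lift_gen.
split=> [|_ _ [a <-] [b <-]]; first by exists 1.
exists (a / b); rewrite free_liftM; congr (_ * _).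
by apply: (mulIg (free_lift f b)); rewrite -free_liftM !mulVg.
Qed.

Lemma generated_gen k : generated (range (@free_gen k)) = [set: free_group k].
Proof.
have sG := generated_subgroup (range (@free_gen k)).
apply/seteqP; split=> // w _.
have -> : w = free_lift (@free_gen k) w.
  by apply: (@free_lift_unique _ k (@free_gen k) id).
rewrite /free_lift; elim: (free_word w) => [|l s IHs].
  by rewrite big_nil; apply: sG.1.
rewrite big_cons; apply: (subgroupM sG) => //.
have Gl : generated (range (@free_gen k)) (free_gen l.1).
  by apply: sub_generated; exists l.1.
by rewrite /letter_eval; case: l.2 => //; apply: (subgroupV sG).
Qed.

Lemma ord2E (i : 'I_2) : i = i0 \/ i = i1.
Proof. by case: i => [[|[|//]]] ?; [left|right]; apply: val_inj. Qed.

Lemma two_letters (l m : letter 2) (P : 'I_2 -> Prop) :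
  l.1 != m.1 -> P l.1 -> P m.1 -> forall i, P i.
Proof.
move=> lm Pl Pm i.
by case: (ord2E l.1) (ord2E m.1) (ord2E i) lm Pl Pm => -> [] -> [] ->.
Qed.

Lemma letters_generate (G : groupType) (f : 'I_2 -> G) (l m : letter 2) :
  l.1 != m.1 ->
  generated (range f) `<=` generated [set letter_eval f l; letter_eval f m].
Proof.
move=> lm; have sG := generated_subgroup [set letter_eval f l; letter_eval f m].
set S := generated _ in sG *.
have base n : S (letter_eval f n) -> S (f n.1).
  by rewrite /letter_eval; case: n.2 => // /(subgroupV sG); rewrite invgK.
apply: generated_min => // _ [i _ <-].
apply: (@two_letters l m (fun j => S (f j)) lm); apply: base.
  exact: mem_gen2l.
exact: mem_gen2r.
Qed.

Lemma letters_commutator (G : groupType) (f : 'I_2 -> G) (l m : letter 2) :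
  l.1 != m.1 ->
  conj_pm [~ letter_eval f l, letter_eval f m] [~ f i0, f i1].
Proof.
move=> lm.
have inv_l (u v : G) (b : bool) :
    conj_pm [~ if b then u^-1 else u, v] [~ u, v].
  by case: b; [apply: conj_pm_commgV|exists 1; left; rewrite conjg1].
have inv_r (u v : G) (b : bool) :
    conj_pm [~ u, if b then v^-1 else v] [~ u, v].
  apply: conj_pm_trans (conj_pm_commgC _ _) _.
  exact: conj_pm_trans (inv_l _ _ _) (conj_pm_commgC _ _).
apply: conj_pm_trans (inv_l _ _ _) _; apply: conj_pm_trans (inv_r _ _ _) _.
case: (ord2E l.1) (ord2E m.1) lm => -> [] -> // _; last exact: conj_pm_commgC.
by exists 1; left; rewrite conjg1.
Qed.

Lemma not_nielsen_reduced f : ~ nielsen_reduced f ->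
  exists l m n : letter 2, let e : letter 2 -> F := letter_eval f in
  [/\ m != letter_inv l, n != letter_inv m &
     free_len (e m) <= free_lcp (e l)^-1 (e m) + free_lcp (e m)^-1 (e n)].
Proof.
move=> /existsNP[l] /existsNP[m] /existsNP[n] /not_implyP[ml].
move=> /not_implyP[nm] /negP.
by rewrite -leqNgt => le_m; exists l, m, n.
Qed.

(** What a step of the reduction has to provide; the steps are compositions of
Nielsen moves and simultaneous conjugations. *)
Definition shortens (x y x' y' : F) : Prop :=
  [/\ free_len x' + free_len y' < free_len x + free_len y,
      generated [set x; y] = setT -> generated [set x'; y'] = setT
    & conj_pm [~ x, y] [~ x', y']].

Lemma shortens_mul (x y : F) :
  free_len y < (free_lcp x^-1 y).*2 -> shortens x y (x * y) y.
Proof.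
move=> lt_y; split; [by have := free_lenM x y; lia| |].
  move=> genT; apply/seteqP; split=> // g _.
  have: generated [set x; y] g by rewrite genT.
  apply: generated2_sub; last exact: mem_gen2r.
  have sS := generated_subgroup [set x * y; y].
  by have := sS.2 _ _ (@mem_gen2l _ _ _) (@mem_gen2r _ _ _); rewrite mulgK.
exact/conj_pm_sym/conj_pm_commg_mulr.
Qed.

(** Here y cancels one half of itself on each side in x * y * x, and no Nielsen
move shortens the pair.  Write y = p * q^-1 with p and q of equal length.  Then
x begins with q and ends with p^-1, so conjugating y * x by p removes p and q
from the two ends of x, while the conjugate q^-1 * p of y is not longer than y.
*)
Lemma shortens_conj (x y : F) : y != 1 -> free_len y <= free_len x ->
    (free_lcp x^-1 y).*2 = free_len y -> (free_lcp y^-1 x).*2 = free_len y ->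
  exists t, shortens x y ((y * x) ^ t) (y ^ t).
Proof.
move=> y1 le_yx xy yx; set h := free_lcp x^-1 y in xy.
have y_gt0 : 0 < free_len y.
  by rewrite lt0n; apply: contra y1 => /eqP/free_len_eq0->.
have [|p len_p lcp_p] := @free_prefix _ y h; first by lia.
pose q : F := y^-1 * p.
have len_q : free_len q = h.
  by have := free_len_lcp y p; rewrite (free_lcpC y) lcp_p -/q; lia.
have lcp_qy : free_lcp q y^-1 = h.
  have := free_lcpMl y^-1 p.
  by rewrite invgK free_lenV (free_lcpC y) lcp_p -/q; lia.
have lcp_qx := free_lcp_ultrametric q y^-1 x.
have lcp_px := free_lcp_ultrametric x^-1 y p.
rewrite (free_lcpC y) lcp_p -/h in lcp_px.
have lcp_px_le := free_lcp_ler x^-1 p.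
have lcp_xp := free_lcpMl x p.
have lcp_qxp := free_lcp_ultrametric q x (x * p).
have len_xp := free_lenM x p.
have len_qxp := free_len_lcp q (x * p).
have len_qp := free_len_lcp q p.
have yxE : (y * x) ^ p = q^-1 * (x * p).
  by rewrite /q invgM invgK /conjg -!mulgA.
have yE : y ^ p = q^-1 * p by rewrite /q invgM invgK /conjg -!mulgA.
exists p; split; first by rewrite yxE yE (free_lcpC x) in lcp_qxp *; lia.
  move=> genT; apply/seteqP; split=> // g _.
  set S := generated _; have sS : is_subgroup S := generated_subgroup _.
  suff SJ a : S (a ^ p) by rewrite -[g](conjgKV p).
  have: generated [set x; y] a by rewrite genT.
  apply: (@generated2_min _ [set b | S (b ^ p)]).
  - split=> [|b c Sb Sc]; first by rewrite /= conj1g; apply: sS.1.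
    by rewrite /= conjMg conjVg; apply: sS.2.
  - rewrite /= -[x](mulKg y) conjMg conjVg; apply: (subgroupM sS).
      by apply: (subgroupV sS); apply: mem_gen2r.
    exact: mem_gen2l.
  - exact: mem_gen2r.
rewrite -conjRg; apply/conj_pm_sym; exists p; left; congr (_ ^ _).
by rewrite /commg /conjg !invgM -!mulgA !mulKg.
Qed.

(** A group generated by two commuting elements is abelian, and free_gen i0 does
not commute with free_gen i1. *)
Lemma commuting_pair_not_generating (f : 'I_2 -> F) :
  generated (range f) = setT -> [~ f i0, f i1] != 1.
Proof.
move=> genT; apply/eqP => f1.
have: derived (generated [set f i0; f i1]) [~ free_gen i0, free_gen i1].
  have allT g : generated [set f i0; f i1] g.
    have: generated (range f) g by rewrite genT.
    exact: (@letters_generate _ f (i0, false) (i1, false)).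
  exact: mem_derived.
have s1 : is_subgroup [set 1 : F].
  by split=> // _ _ -> ->; rewrite /= mulgV.
have norm1 g : normalizer [set 1 : F] g.
  move=> a; split=> /= [/eqP|->]; last exact: conj1g.
  by rewrite conjg_eq1 => /eqP.
by move=> /(derived_gen2_sub s1 (norm1 _) (norm1 _) f1) /(congr1 val).
Qed.

(** Each basis element has length one, so it is the image of a word of length
one: up to order and inversion, the pair is the basis. *)
Lemma nielsen_reduced_basis (f : 'I_2 -> F) :
  generated (range f) = setT -> nielsen_reduced f ->
  conj_pm [~ f i0, f i1] [~ free_gen i0, free_gen i1].
Proof.
move=> genT fN; have letterE i : exists l, letter_eval f l = free_gen i.
  have [|w wi] := @generated_lift _ _ f (free_gen i); first by rewrite genT.
  have := nielsen_reduced_len fN w; rewrite wi /free_len /=.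
  case: w wi => [[|l [|//]] rw] wi //= _.
    by move/(congr1 val): wi; rewrite /free_lift big_nil.
  by exists l; rewrite -wi /free_lift big_seq1.
have [l le] := letterE i0; have [m me] := letterE i1.
have lm : l.1 != m.1.
  apply/eqP => lm.
  have : free_gen i0 = free_gen i1 \/ free_gen i0 = (free_gen i1)^-1 :> F.
    rewrite -le -me /letter_eval lm.
    by case: l.2 m.2 => [] []; rewrite ?invgK; [left|right|right|left].
  by case=> /(congr1 val).
by rewrite -le -me; apply/conj_pm_sym/letters_commutator.
Qed.

(** Induction on the total length of the pair.  When two cancellations meet
inside e m, with e l before it and e r after it, either one of them exceeds
half of e m, and a Nielsen move shortens the pair, or both are equal to one
half.  In the latter case e l and e r are both the other element of the pair or
its inverse, and they are equal, since otherwise half of e m would cancel in e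
m * e m; the pair is then shortened by another Nielsen move or by the
conjugation above. *)
Lemma basis_commutator (f : 'I_2 -> F) : generated (range f) = setT ->
  conj_pm [~ f i0, f i1] [~ free_gen i0, free_gen i1].
Proof.
have [n] := ubnP (free_len (f i0) + free_len (f i1)).
elim: n f => // n IHn f lt_n genT.
have [fN|/not_nielsen_reduced[l [m [r /= [ml rm]]]]] := EM (nielsen_reduced f).
  exact: nielsen_reduced_basis.
pose e : letter 2 -> F := letter_eval f; rewrite -!/(e _) => le_m.
have step (a b : letter 2) (x y : F) : a.1 != b.1 -> shortens (e a) (e b) x y ->
    conj_pm [~ f i0, f i1] [~ free_gen i0, free_gen i1].
  move=> ab [lt_xy gen_xy conj_xy].
  apply: conj_pm_trans (conj_pm_sym (letters_commutator f ab)) _.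
  apply: conj_pm_trans conj_xy _.
  pose f' i := if i == i0 then x else y.
  apply: (IHn f'); rewrite /f' /=.
    suff eq_len : free_len (e a) + free_len (e b) =
        free_len (f i0) + free_len (f i1).
      by rewrite eq_len in lt_xy; apply: leq_trans lt_xy _.
    have lenE c : free_len (e c) = free_len (f c.1).
      by rewrite /e /letter_eval; case: c.2; rewrite ?free_lenV.
    rewrite !lenE.
    by case: (ord2E a.1) (ord2E b.1) ab => -> [] -> // _; rewrite addnC.
  apply/seteqP; split=> // g _.
  have: generated [set x; y] g.
    rewrite gen_xy//; apply/seteqP; split=> // h _.
    by apply: (letters_generate ab); rewrite genT.
  apply: (generated2_min (generated_subgroup _)); apply: sub_generated.
    by exists i0.
  by exists i1.
have eV a : e (letter_inv a) = (e a)^-1 by apply: letter_eval_inv.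
have e1 : e m != 1.
  apply: contra (commuting_pair_not_generating genT) => /eqP em1.
  have fm : f m.1 = 1.
    move: em1; rewrite /e /letter_eval; case: m.2 => // /eqP.
    by rewrite invg_eq1 => /eqP.
  suff [->|->] : f i0 = 1 \/ f i1 = 1 by rewrite ?comm1g ?commg1.
  by rewrite -fm; case: (ord2E m.1) => ->; [left|right].
have self := free_lcp_self e1.
have same (a b : letter 2) : b != letter_inv a -> a.1 = b.1 -> a = b.
  case: a b => [i b] [j c] /= + ij; rewrite -{}ij xpair_eqE eqxx /=.
  by case: b c => [] [].
have other (a b : letter 2) : a.1 != m.1 -> b.1 != m.1 -> a.1 = b.1.
  by case: (ord2E a.1) (ord2E b.1) (ord2E m.1) => -> [] -> [] ->.
(* If e l or e r is e m itself, the cancellation on that side is less than half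
   of e m, so the other one is more than half. *)
have [lm|lm] := eqVneq l.1 m.1; have [rm'|rm'] := eqVneq r.1 m.1.
- move: le_m; rewrite (same _ _ ml lm) (same _ _ rm (esym rm')) => le_m.
  by rewrite -(same _ _ rm (esym rm')) in le_m; lia.
- apply: (step (letter_inv r) (letter_inv m)) => //.
  apply: shortens_mul; rewrite !eV invgK free_lenV free_lcpC.
  by rewrite (same _ _ ml lm) in le_m *; lia.
- apply: (step l m) => //; apply: shortens_mul.
  by rewrite -(same _ _ rm (esym rm')) in le_m; lia.
have [lt_xy|le_xy] := ltnP (free_len (e m)) (free_lcp (e l)^-1 (e m)).*2.
  by apply: (step l m) => //; apply: shortens_mul.
have [lt_yz|le_yz] := ltnP (free_len (e m)) (free_lcp (e m)^-1 (e r)).*2.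
  apply: (step (letter_inv r) (letter_inv m)) => //.
  by apply: shortens_mul; rewrite !eV invgK free_lenV free_lcpC.
have [rl|rl] := eqVneq r (letter_inv l).
  rewrite rl eV in le_m le_yz.
  by have := free_lcp_ultrametric (e m)^-1 (e l)^-1 (e m); lia.
have {rl} rl := same _ _ rl (other _ _ lm rm').
rewrite -{r}rl in le_m le_yz rm rm'.
have [le_ml|lt_lm] := leqP (free_len (e m)) (free_len (e l)).
  have [||t] := shortens_conj e1 le_ml; [lia|lia|].
  exact: step.
have ml' : m.1 != l.1 by rewrite eq_sym.
by apply: (step _ _ _ _ ml'); apply: shortens_mul; lia.
Qed.

End RankTwo.

Section NielsenInvariant.
Variable G : groupType.

Lemma free_lift1 k (g : 'I_k -> G) : free_lift g 1 = 1.
Proof. by rewrite /free_lift big_nil. Qed.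

Lemma free_liftV k (g : 'I_k -> G) a : free_lift g a^-1 = (free_lift g a)^-1.
Proof.
by apply: (mulIg (free_lift g a)); rewrite -free_liftM !mulVg free_lift1.
Qed.

Lemma free_liftJ k (g : 'I_k -> G) a b :
  free_lift g (a ^ b) = free_lift g a ^ free_lift g b.
Proof. by rewrite /conjg !free_liftM free_liftV. Qed.

Lemma free_liftR k (g : 'I_k -> G) a b :
  free_lift g [~ a, b] = [~ free_lift g a, free_lift g b].
Proof. by rewrite /commg free_liftM free_liftJ free_liftV. Qed.

Lemma group_aut_generates k (f : group_aut (free_group k)) :
  generated (range (fun i => group_aut_inv f (free_gen i))) = setT.
Proof.
set S := generated _; have sS : is_subgroup S := generated_subgroup _.
have fVM a b : group_aut_inv f (a * b) = group_aut_inv f a * group_aut_inv f b.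
  by apply: (can_inj (group_autK f)); rewrite group_autM !group_autVK.
have fV1 : group_aut_inv f 1 = 1.
  by apply: (mulIg (group_aut_inv f 1)); rewrite -fVM !mul1g.
apply/seteqP; split=> // g _; rewrite -[g](group_autK f).
have: generated (range (@free_gen k)) (f g) by rewrite generated_gen.
apply: (@generated_min _ [set a | S (group_aut_inv f a)]) => [|_ [i _ <-]].
  split=> [|a b Sa Sb] /=; first by rewrite fV1; apply: sS.1.
  rewrite fVM; apply: (subgroupM sS) => //.
  suff -> : group_aut_inv f b^-1 = (group_aut_inv f b)^-1.
    exact: (subgroupV sS).
  by apply: (mulIg (group_aut_inv f b)); rewrite -fVM !mulVg.
by apply: sub_generated; exists i.
Qed.

Lemma nielsen_class_commutator (g h : 'I_2 -> G) : nielsen_class g h ->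
  conj_pm [~ h ord0, h ord_max] [~ g ord0, g ord_max].
Proof.
case=> tau _ <-; rewrite /nielsen_act -free_liftR.
have [t /=] := basis_commutator (group_aut_generates tau).
move=> tE; exists (free_lift g t).
by case: tE => ->; rewrite free_liftJ ?free_liftV free_liftR !free_lift_gen;
  [left|right].
Qed.

End NielsenInvariant.

(** * Depths of the first-level sections of a tree automorphism *)

Section Depths.
Variable p : nat.
Implicit Types (f g t : tree_aut p) (s : 'I_p) (v w : vertex p).

(** The vertex f (rcons v s) is a neighbour of f v.  It is not the parent of f v,
which by induction is the image of the parent of v. *)
Lemma tree_aut_rcons f v s : exists r, f (rcons v s) = rcons (f v) r.
Proof.
elim/last_ind: v s => [|v r IHv] s.
  have /(tree_aut_adj f) : adjacent [::] (rcons [::] s) by left; exists s.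
  rewrite tree_aut_root => -[[r ->]|[r /esym]]; first by exists r.
  by move/(congr1 size); rewrite size_rcons.
have /(tree_aut_adj f) : adjacent (rcons v r) (rcons (rcons v r) s).
  by left; exists s.
case=> [[r' ->]|[r' fE]]; first by exists r'.
have [r'' fE'] := IHv r; move: fE; rewrite {1}fE' => /rcons_inj[fv _].
have /(congr1 size) := can_inj (@tree_autK _ f) fv.
by rewrite !size_rcons; lia.
Qed.

Lemma tree_aut_cat f v w :
  exists2 w', size w' = size w & f (v ++ w) = f v ++ w'.
Proof.
elim/last_ind: w => [|w s [w' sw' fE]]; first by exists [::]; rewrite ?cats0.
have [r fr] := tree_aut_rcons f (v ++ w) s.
by exists (rcons w' r); rewrite ?size_rcons ?sw'// -!rcons_cat fr fE rcons_cat.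
Qed.

Definition fixes f n : Prop := forall v, size v <= n -> f v = v.

Definition fixes_below f s n : Prop :=
  forall v, size v <= n -> f (s :: v) = s :: v.

(** The levels at which the sections of f below the first-level letters stop
being trivial.  A letter contributes at most one level, which makes this set
finite. *)
Definition depths f : set nat :=
  [set n | exists s, fixes_below f s n /\ ~ fixes_below f s n.+1].

Lemma finite_depths f : finite_set (depths f).
Proof.
pose D s := [set n | fixes_below f s n /\ ~ fixes_below f s n.+1].
apply: (@sub_finite_set _ _ (\bigcup_s D s)).
  by move=> n [s Dsn]; exists s.
apply: bigcup_finite => [|s _]; first exact: finite_finset.
have [->|/set0P[n [fn Nfn]]] := eqVneq (D s) set0; first exact: finite_set0.
apply: (@sub_finite_set _ _ [set n]); last exact: finite_set1.
move=> m [fm Nfm] /=; apply/eqP; rewrite eqn_leq; apply/andP; split.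
  by rewrite leqNgt; apply/negP => lt_nm; apply: Nfn => v sv; apply: fm; lia.
by rewrite leqNgt; apply/negP => lt_nm; apply: Nfm => v sv; apply: fn; lia.
Qed.

(** The letter s' is the image of s under t. *)
Lemma fixes_below_conj f t s :
  exists s', forall n, fixes_below (f ^ t) s n <-> fixes_below f s' n.
Proof.
have [s' ts] := tree_aut_rcons t [::] s; rewrite tree_aut_root /= in ts.
have tsV : t^-1 [:: s'] = [:: s] by rewrite -ts; apply: tree_autK.
exists s' => n; split=> fix_n v sv.
  have [w sw tw] := tree_aut_cat t^-1 [:: s'] v.
  rewrite -[s' :: v](tree_autVK t).
  have {}tw : tree_aut_inv t (s' :: v) = s :: w.
    by rewrite -[LHS]/(t^-1 _) tw tsV.
  rewrite tw; have := fix_n w; rewrite sw => /(_ sv) /(congr1 t).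
  by rewrite /= tree_autVK.
have [w sw tw] := tree_aut_cat t [:: s] v; rewrite ts /= in tw.
by rewrite /= tw fix_n ?sw// -tw tree_autK.
Qed.

Lemma depths_conj f t : depths (f ^ t) `<=` depths f.
Proof.
move=> n [s [fn fSn]].
have [s' fE] := fixes_below_conj f t s.
by exists s'; split; [apply/fE|move=> /fE].
Qed.

Lemma fixes_belowV f s n : fixes_below f s n -> fixes_below f^-1 s n.
Proof. by move=> fix_n v /fix_n fv; rewrite -{1}fv; apply: tree_autK. Qed.

Lemma depthsV f : depths f^-1 `<=` depths f.
Proof.
move=> n [s [fn fSn]]; exists s; split.
  by rewrite -[f]invgK; apply: fixes_belowV.
by move=> /fixes_belowV.
Qed.

Lemma depths_conj_pm f g n :
  conj_pm f g -> depths (f ^+ n) `<=` depths (g ^+ n).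
Proof.
case=> t [] ->; rewrite -conjXg ?expVgn => m /depths_conj//.
exact: depthsV.
Qed.

End Depths.

(** * Automorphisms fixing the first level *)

Section LevelOne.
Variable p : nat.
Implicit Types (F : 'I_p -> tree_aut p) (g : tree_aut p) (v : vertex p).

Definition level1_fun F v : vertex p :=
  if v is s :: w then s :: F s w else [::].

Lemma level1_funK F : cancel (level1_fun F) (level1_fun (fun s => (F s)^-1)).
Proof. by case=> //= s v; congr cons; apply: tree_autK. Qed.

Lemma level1_funVK F : cancel (level1_fun (fun s => (F s)^-1)) (level1_fun F).
Proof. by case=> //= s v; congr cons; apply: tree_autVK. Qed.

Lemma level1_fun_rcons F v s :
  exists r, level1_fun F (rcons v s) = rcons (level1_fun F v) r.
Proof.
case: v => [|s' v] /=; first by exists s; rewrite tree_aut_root.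
by have [r ->] := tree_aut_rcons (F s') v s; exists r.
Qed.

Definition level1 F : tree_aut p :=
  TreeAut (level1_funK F) (level1_funVK F) erefl
    (adjacent_of_rcons (level1_funK F) (level1_fun_rcons F)
       (level1_fun_rcons (fun s => (F s)^-1))).

Lemma level1E F s v : level1 F (s :: v) = s :: F s v.
Proof. by []. Qed.

Lemma eq_level1 F F' : F =1 F' -> level1 F = level1 F'.
Proof. by move=> /funext->. Qed.

Lemma level1M F F' : level1 F * level1 F' = level1 (fun s => F s * F' s).
Proof. by apply: tree_aut_eq => -[]. Qed.

Lemma level11 : level1 (fun=> 1) = 1.
Proof. by apply: tree_aut_eq => -[]. Qed.

Lemma level1V F : (level1 F)^-1 = level1 (fun s => (F s)^-1).
Proof. by apply: tree_aut_eq => -[]. Qed.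

Lemma level1X F n : level1 F ^+ n = level1 (fun s => F s ^+ n).
Proof.
elim: n => [|n IHn]; rewrite ?level11// expgS IHn level1M.
by apply: eq_level1 => s; rewrite expgS.
Qed.

Lemma level1J F F' : level1 F ^ level1 F' = level1 (fun s => F s ^ F' s).
Proof. by rewrite /conjg level1V !level1M. Qed.

Lemma level1R F F' : [~ level1 F, level1 F'] = level1 (fun s => [~ F s, F' s]).
Proof. by rewrite /commg level1J level1V !level1M. Qed.

(** Conjugation by x rotates the sections towards smaller letters. *)
Lemma level1Jx F : level1 F ^ gs_x p = level1 (fun s => F (ordS s)).
Proof. by apply: tree_aut_eq => -[|s v] //=; rewrite ordSK. Qed.

Definition single (j : nat) g : 'I_p -> tree_aut p :=
  fun s => if s == j :> nat then g else 1.

(** The shape of y: the first two letters and the last one carry a section. *)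
Definition triple (g0 g1 gl : tree_aut p) : 'I_p -> tree_aut p := fun s =>
  if s == 0%N :> nat then g0 else if s == 1%N :> nat then g1
  else if s == p.-1 :> nat then gl else 1.

Lemma gs_yE : gs_y p = level1 (triple (gs_x p) (gs_x p)^-1 (gs_y p)).
Proof.
by apply: tree_aut_eq => -[|s v] //=; rewrite /triple; do 3?case: ifP.
Qed.

Lemma ordS_cases (s : 'I_p) :
  (s.+1 = p /\ ordS s = 0 :> nat) \/ (s.+1 < p /\ ordS s = s.+1 :> nat).
Proof.
rewrite /=; have := ltn_ord s; rewrite leq_eqVlt => /predU1P[sp|lt_sp].
  by left; rewrite sp modnn.
by right; rewrite modn_small.
Qed.

(** The product over all letters s of the elements level1 (single s (F s)) is
level1 F; it is formed here one letter at a time. *)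
Lemma subgroup_level1 (S : set (tree_aut p)) F : is_subgroup S ->
  (forall s : 'I_p, S (level1 (single s (F s)))) -> S (level1 F).
Proof.
move=> sS SF.
pose Fn n : 'I_p -> tree_aut p := fun s => if s < n then F s else 1.
suff SFn n : S (level1 (Fn n)).
  have -> : level1 F = level1 (Fn p).
    by apply: eq_level1 => s; rewrite /Fn ltn_ord.
  exact: SFn.
elim: n => [|n IHn].
  have -> : level1 (Fn 0%N) = 1 by rewrite -level11; apply: eq_level1.
  exact: sS.1.
case: (ltnP n p) => [lt_np|le_pn].
  pose sn := Ordinal lt_np.
  have -> : level1 (Fn n.+1) = level1 (Fn n) * level1 (single sn (F sn)).
    rewrite level1M; apply: eq_level1 => s.
    rewrite /Fn /single ltnS leq_eqVlt /=.
    case: eqP => [sE|_] /=; last by rewrite mulg1.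
    by rewrite sE ltnn mul1g; congr F; apply: val_inj.
  exact: (subgroupM sS).
rewrite (_ : level1 (Fn n.+1) = level1 (Fn n)) //; apply: eq_level1 => s.
rewrite /Fn; have sp := ltn_ord s.
have -> : s < n.+1 by lia.
by have -> : s < n by lia.
Qed.

End LevelOne.

(** * Generating pairs *)

Ltac case_letter s :=
  have := ltn_ord s; case: (ordS_cases s) => -[? ?] ?.

(** Evaluates sections given by cases on the letter, from arithmetic facts in
the context. *)
Ltac decide_letters :=
  rewrite /single /triple; repeat (case: eqP => ?; try (exfalso; lia));
  rewrite ?conjg1 ?conj1g ?commg1 ?comm1g //.

Section Generation.
Variable p : nat.
(* For p = 4 the rotations of the support of triple by 0 and by 2 meet in two
   letters. *)
Hypotheses (p_gt2 : 2 < p) (p_neq4 : p != 4).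
Variables (u v d : tree_aut p).
Let M := generated [set u; v].
Hypotheses (dM : derived M d) (ud : u ^ d = u) (vp : v ^+ p = 1).

(** The twist sits at the letter where twisted_y has the section u^-1.
Rotations move the three sections away from that letter, so for p > 4 the
conjugates of twisted_y by the first two powers of twisted_x do not involve d.
*)
Definition twisted_x : tree_aut p := gs_x p * level1 (single 1 d).
Definition twisted_y : tree_aut p := level1 (triple u u^-1 v).
Let a := twisted_x.
Let b := twisted_y.
Let L := generated [set a; b].
Let sL : is_subgroup L. Proof. exact: generated_subgroup. Qed.
Let La : L a. Proof. exact: mem_gen2l. Qed.
Let Lb : L b. Proof. exact: mem_gen2r. Qed.
Let sD : is_subgroup (derived L). Proof. exact: derived_subgroup. Qed.
Let sM : is_subgroup M. Proof. exact: generated_subgroup. Qed.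

Lemma level1_twisted F :
  level1 F ^ a = level1 (fun s => F (ordS s) ^ single 1 d s).
Proof. by rewrite conjgM level1Jx level1J. Qed.

(** The sections of the elements of derived L supported below the last letter.
The derived subgroup of L is used instead of L so that elements of derived M
end up in the derived subgroup of the whole group. *)
Let K : set (tree_aut p) := [set g | derived L (level1 (single p.-1 g))].

Let sK : is_subgroup K.
Proof.
split=> [|g h Kg Kh].
  rewrite /K /= (_ : level1 _ = 1); first exact: sD.1.
  by apply: etrans (eq_level1 _) (level11 p) => s; rewrite /single; case: ifP.
rewrite /K /= (_ : level1 _ = level1 (single p.-1 g) / level1 (single p.-1 h)).
  exact: sD.2.
rewrite level1V level1M; apply: eq_level1 => s.
by rewrite /single; case: ifP => // _; rewrite mulgV.
Qed.

Let normK F g : L (level1 F) -> (forall s : 'I_p, s = p.-1 :> nat -> F s = g) ->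
  normalizer K g.
Proof.
move=> LF Fg h; rewrite /K /= -(derived_normal sL LF (level1 (single p.-1 h))).
rewrite level1J.
rewrite (_ : level1 (single _ _) = level1 (fun s => single p.-1 h s ^ F s))//.
apply: eq_level1 => s; rewrite /single.
by case: eqP => [/Fg->|_]; rewrite ?conj1g.
Qed.

Let normKv : normalizer K v.
Proof.
apply: (normK Lb) => s sp; rewrite /triple sp eqxx.
by do 2?case: eqP => //; lia.
Qed.

Let normKu : normalizer K u.
Proof.
have := subgroupJ sL Lb La; rewrite level1_twisted => /normK; apply=> s sp.
case_letter s; decide_letters.
Qed.

Let memK F g :
  derived L (level1 F) -> (forall s, F s = single p.-1 g s) -> K g.
Proof. by move=> LF Fg; rewrite /K /= -(eq_level1 Fg). Qed.

(** Rotated by two letters, the support of b meets the support of b only in the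
last letter, with sections u^-1 and v. *)
Let K_of_big : 4 < p -> K [~ u, v].
Proof.
move=> p_gt4.
suff: K ([~ u, v] ^ u^-1) by move/(subgroupV (normalizer_subgroup K) normKu).
have -> : [~ u, v] ^ u^-1 = [~ v, u^-1].
  by rewrite /commg /conjg !invgK !mulgA mulgV mul1g.
have := mem_derived Lb (subgroupJ sL (subgroupJ sL Lb La) La).
rewrite !level1_twisted level1R => /memK; apply=> s.
case_letter s; case_letter (ordS s); decide_letters.
Qed.

(** All rotations of b have full support.  Three rotations bring b back to
itself, except that v becomes v ^ d; this gives [~ v, d].  The product of b by
its rotation has a trivial section, so it meets its own rotations in one letter
only; this gives [~ v * u, u^-1 * v ^ d], which is [~ u, v ^+ 2] modulo [~ v,
d].  Finally v ^+ 2 is v^-1. *)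
Let K_of_3 : p = 3 -> K [~ u, v].
Proof.
move=> p3.
have Kvd : K [~ v, d].
  have := mem_derived Lb (subgroupM sL La (subgroupM sL La La)).
  rewrite commgEl (conjgM b a) (conjgM _ a a) !level1_twisted level1V level1M.
  move=> /memK; apply=> s.
  case_letter s; case_letter (ordS s); case_letter (ordS (ordS s)).
  all: decide_letters.
  by rewrite conjVg ud mulVg.
  by rewrite ud mulVg.
have Kc : K [~ v * u, u^-1 * v ^ d].
  have cE : b * b ^ a = level1 (fun s =>
      triple u u^-1 v s * triple u u^-1 v (ordS s) ^ single 1 d s).
    by rewrite level1_twisted level1M.
  have Lc : L (b * b ^ a) by apply: (subgroupM sL) => //; apply: (subgroupJ sL).
  have := mem_derived Lc (subgroupJ sL (subgroupJ sL Lc La) La).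
  rewrite cE (level1_twisted (fun s => _ s * _)) level1_twisted level1R.
  move=> /memK; apply=> s.
  case_letter s; case_letter (ordS s); case_letter (ordS (ordS s)).
  all: decide_letters.
  by rewrite mulgV conj1g commg1.
  by rewrite mulgV comm1g.
have Kc' : K ([~ u, v * v] ^ [~ v, d]).
  have Nvu := subgroupM (normalizer_subgroup K) normKv normKu.
  suff -> : [~ u, v * v] ^ [~ v, d] =
      [~ v, d]^-1 * [~ v, d] ^ (v * u) * [~ v * u, u^-1 * v ^ d].
    apply: (subgroupM sK) => //; apply: (subgroupM sK).
      exact: (subgroupV sK).
    exact/Nvu.
  have -> : v ^ d = v * [~ v, d] by rewrite commgEl mulVKg.
  move: [~ v, d] => w.
  by rewrite /commg /conjg !gnorm.
have {}Kc : K [~ u, v * v].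
  by have := subgroupJ sK Kc' (subgroupV sK Kvd); rewrite conjgK.
have v3 : v ^+ 3 = 1 by rewrite -[RHS]vp; congr (_ ^+ _).
have vvE : v * v = v^-1 by apply/eqP; rewrite -mulg_eq1 -mulgA -v3.
rewrite vvE in Kc; suff: K ([~ u, v] ^ v^-1).
  by move/(subgroupV (normalizer_subgroup K) normKv).
suff -> : [~ u, v] ^ v^-1 = [~ u, v^-1]^-1 by apply: (subgroupV sK).
by rewrite /commg /conjg !invgM !invgK !mulgA mulgK.
Qed.

Let K_derived : derived M `<=` K.
Proof.
apply: derived_gen2_sub => //; have [p_gt4|p_le4] := ltnP 4 p.
  exact: K_of_big.
by apply: K_of_3; lia.
Qed.

(** From the last letter, conjugation by a carries a section to every letter; on
the way it may be conjugated by d, which normalizes derived M. *)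
Lemma derived_single j g :
  j < p -> derived M g -> derived L (level1 (single j g)).
Proof.
move=> lt_jp; rewrite -[j](subKn (_ : j <= p.-1)); last by lia.
elim: (p.-1 - j) g => [|k IHk] g Mg; first by rewrite subn0; apply: K_derived.
have [lt_kp|le_pk] := ltnP k p.-1; last first.
  by have := IHk g Mg; have -> : p.-1 - k.+1 = p.-1 - k by lia.
set i := p.-1 - k.+1; have iS : p.-1 - k = i.+1 by rewrite /i; lia.
pose t := if i == 1%N then d else 1.
have Mt : M t.
  by rewrite /t; case: eqP => _; [apply: (derived_sub sM)|apply: sM.1].
have /IHk : derived M (g ^ t^-1) by apply/(derived_normal sM (subgroupV sM Mt)).
rewrite iS -(derived_normal sL La) level1_twisted.
rewrite (_ : level1 _ = level1 (single i g)) //.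
apply: eq_level1 => s; rewrite -[RHS](conjgKV (single 1 d s)); congr (_ ^ _).
rewrite /t; case_letter s; decide_letters.
all: try by rewrite ?invg1 ?conjg1.
Qed.

End Generation.

Section GeneratingPairs.
Variable p : nat.
Hypotheses (p_gt2 : 2 < p) (p_neq4 : p != 4).
Notation x := (gs_x p).
Notation y := (gs_y p).
Notation G := (@gupta_sidki p).

Let sG : is_subgroup G. Proof. exact: generated_subgroup. Qed.

Lemma iter_ordS_val (s : 'I_p) n : iter n (@ordS p) s = (s + n) %% p :> nat.
Proof.
elim: n => [|n IHn]; first by rewrite addn0 modn_small.
by rewrite iterS /= IHn addnS -addn1 modnDml addn1.
Qed.

Lemma gs_xXE n (s : 'I_p) v : (x ^+ n) (s :: v) = iter n (@ordS p) s :: v.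
Proof. by elim: n => // n IHn; rewrite expgS /= IHn. Qed.

Lemma gs_xXp : x ^+ p = 1.
Proof.
apply: tree_aut_eq => -[|s v]; first by rewrite !tree_aut_root.
rewrite gs_xXE; congr cons; apply: val_inj.
by rewrite /= iter_ordS_val modnDr modn_small.
Qed.

Lemma gs_yXp : y ^+ p = 1.
Proof.
apply: tree_aut_eq; elim=> [|s v IHv]; first by rewrite !tree_aut_root.
rewrite gs_yE level1X level1E /triple.
have VXp : x^-1 ^+ p = 1 by rewrite expVgn gs_xXp invg1.
by do 3?case: ifP => _; rewrite ?gs_xXp ?VXp ?expg1n ?IHv.
Qed.

Lemma twisted_x1 : twisted_x 1 = x.
Proof.
rewrite /twisted_x (_ : level1 _ = 1) ?mulg1//.
by apply: etrans (eq_level1 _) (level11 p) => s; rewrite /single; case: ifP.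
Qed.

Lemma twisted_yE : twisted_y x y = y.
Proof. by rewrite /twisted_y -gs_yE. Qed.

(** The previous construction for the pair (x, y) without twist. *)
Lemma gs_derived_single j g :
  j < p -> derived G g -> derived G (level1 (single j g)).
Proof.
have := @derived_single p p_gt2 p_neq4 x y 1 (derived_subgroup G).1
  (conjg1 x) gs_yXp j g.
by rewrite twisted_x1 twisted_yE.
Qed.

(** The sections of y^-1 * twisted_y u v belong to the derived subgroup. *)
Lemma twisted_y_mem (S : set (tree_aut p)) (u v : tree_aut p) : is_subgroup S ->
    (forall j g, j < p -> derived G g -> S (level1 (single j g))) ->
    derived G (x^-1 * u) -> derived G (y^-1 * v) -> S (y^-1 * twisted_y u v).
Proof.
move=> sS Sd Du Dv; rewrite {1}gs_yE level1V level1M.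
apply: subgroup_level1 => // s; apply: Sd => //.
have sD := derived_subgroup G.
have Dxu : derived G (x / u).
  have NxV := derived_normal sG (subgroupV sG (@mem_gen2l _ x y)).
  have -> : x / u = ((x^-1 * u) ^ x^-1)^-1.
    by rewrite /conjg invgK -mulgA mulVKg invgF.
  by apply: (subgroupV sD); apply/NxV.
rewrite /triple; do 3?case: ifP => _ //; rewrite ?invgK //.
by rewrite invg1 mulg1; apply: sD.1.
Qed.

Lemma twisted_pair_generates (u v d : tree_aut p) :
    generated [set u; v] = G -> derived G (x^-1 * u) -> derived G (y^-1 * v) ->
    derived G d -> u ^ d = u -> v ^+ p = 1 ->
  generated [set twisted_x d; twisted_y u v] = G.
Proof.
move=> Guv Du Dv Dd ud vp; have Gd := derived_sub sG.
apply/seteqP; split.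
  apply: (generated2_min sG).
    apply: (subgroupM sG); first exact: mem_gen2l.
    by apply: Gd; apply: gs_derived_single => //; lia.
  rewrite -[twisted_y u v](mulVKg y); apply: (subgroupM sG).
    exact: mem_gen2r.
  apply: twisted_y_mem => // j g lt_jp Dg; apply: Gd.
  exact: gs_derived_single.
set L := generated _; have sL : is_subgroup L := generated_subgroup _.
have Ld j g : j < p -> derived G g -> L (level1 (single j g)).
  move=> lt_jp; rewrite -Guv => Dg; apply: (derived_sub sL).
  by apply: derived_single; rewrite ?Guv // -Guv.
apply: (generated2_min sL).
  have Ld1 : L (level1 (single 1 d)) by apply: Ld => //; lia.
  by have := sL.2 _ _ (@mem_gen2l _ _ _) Ld1; rewrite mulgK.
have Lyb : L (y^-1 * twisted_y u v) by apply: twisted_y_mem.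
have := sL.2 _ _ Lyb (@mem_gen2r _ _ _); rewrite mulgK => /(subgroupV sL).
by rewrite invgK.
Qed.

End GeneratingPairs.

(** * Generating pairs with commutators of prescribed depth *)

Definition diag p (g : tree_aut p) : tree_aut p := level1 (fun=> g).

(** Along the orbit of s under the rotation, the letter of value 1 is met after
1 - s steps if s <= 1, and after p + 1 - s steps otherwise; there d is applied.
*)
Lemma twisted_xXE p (d : tree_aut p) n (s : 'I_p) v : n <= p ->
  (twisted_x d ^+ n) (s :: v) =
  iter n (@ordS p) s ::
    (if (if s <= 1 then 1 - s else p.+1 - s) < n then d v else v).
Proof.
elim: n => [|n IHn] le_np; first by rewrite ltn0.
have aE r w : twisted_x d (r :: w) = ordS r :: single 1 d r w by [].
have mulE (f g : tree_aut p) w : (f * g) w = f (g w) by [].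
rewrite expgS mulE IHn ?(ltnW le_np)// aE iterS; congr cons; rewrite /single.
have -> : (iter n (@ordS p) s == 1%N :> nat) =
    (n == (if s <= 1 then 1 - s else p.+1 - s)).
  rewrite iter_ordS_val; have sp := ltn_ord s.
  have [lt_p|le_p] := ltnP (s + n) p.
    by rewrite modn_small//; case: leqP; lia.
  have -> : (s + n) %% p = s + n - p.
    by rewrite -{1}(subnK le_p) modnDr modn_small//; lia.
  by case: leqP; lia.
by rewrite ltnS; case: ltngtP.
Qed.

Lemma twisted_xXp p (d : tree_aut p) : 1 < p -> twisted_x d ^+ p = diag d.
Proof.
move=> p_gt1; apply: tree_aut_eq => -[|s v]; first by rewrite !tree_aut_root.
rewrite twisted_xXE// /diag level1E; congr cons.
  by apply: val_inj; rewrite /= iter_ordS_val modnDr modn_small.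
by have := ltn_ord s; case: (leqP s 1) => s1 sp; case: ifP => //; lia.
Qed.

Lemma fixes_diag p (g : tree_aut p) k n : 0 < p ->
  fixes (iter k (@diag p) g) (k + n) <-> fixes g n.
Proof.
move=> p_gt0; elim: k => [|k IHk]; first by rewrite add0n.
rewrite -IHk addSn iterS; set h := iter k _ g; split=> fix_n v sv.
  by have := fix_n (Ordinal p_gt0 :: v) sv; rewrite /diag level1E => -[].
by case: v sv => [|s v] sv; rewrite ?tree_aut_root// /diag level1E fix_n.
Qed.

Section Pairs.
Variable p : nat.
Hypotheses (p_gt2 : 2 < p) (p_neq4 : p != 4).
Notation x := (gs_x p).
Notation y := (gs_y p).
Notation G := (@gupta_sidki p).

Let sG : is_subgroup G. Proof. exact: generated_subgroup. Qed.

Lemma diag_derived g : derived G g -> derived G (diag g).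
Proof.
move=> Dg; apply: (subgroup_level1 (derived_subgroup G)) => s.
exact: gs_derived_single.
Qed.

(** Lies in the derived subgroup, fixes level n + 1, and commutes with x as soon
as n is positive. *)
Definition deep n : tree_aut p := iter n (@diag p) [~ x, y].

Lemma deep_derived n : derived G (deep n).
Proof.
elim: n => [|n IHn]; last exact: diag_derived.
by apply: mem_derived; [exact: mem_gen2l|exact: mem_gen2r].
Qed.

Lemma x_deep n : x ^ deep n.+1 = x.
Proof.
apply/conjg_fixP; rewrite commg1_sym; apply/conjg_fixP.
by rewrite /deep iterS /diag level1Jx.
Qed.

Definition deep_x n : tree_aut p := twisted_x (deep n.+1).

Lemma derived_deep_x n : derived G (x^-1 * deep_x n).
Proof.
rewrite /deep_x /twisted_x mulKg; apply: gs_derived_single => //; first by lia.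
exact: deep_derived.
Qed.

Lemma deep_x_y_generate n : generated [set deep_x n; y] = G.
Proof.
rewrite -[in LHS](twisted_yE p) /deep_x.
apply: twisted_pair_generates; rewrite ?mulVg ?x_deep ?gs_yXp //.
- exact: (derived_subgroup G).1.
- exact: (derived_subgroup G).1.
exact: deep_derived.
Qed.

Definition deep_y n : tree_aut p := twisted_y (deep_x n) y.

Lemma x_deep_y_generate n : generated [set x; deep_y n] = G.
Proof.
rewrite -[in LHS](twisted_x1 p); apply: twisted_pair_generates.
- exact: p_gt2.
- exact: p_neq4.
- exact: deep_x_y_generate.
- exact: derived_deep_x.
- by rewrite mulVg; apply: (derived_subgroup G).1.
- exact: (derived_subgroup G).1.
- exact: conjg1.
exact: gs_yXp.
Qed.

Lemma commutator_level1 F :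
  [~ x, level1 F] = level1 (fun s => (F (ordS s))^-1 * F s).
Proof. by rewrite commgEr level1V level1Jx level1M. Qed.

Let p_gt0 : 0 < p. Proof. by lia. Qed.

Lemma triple_first (u v : tree_aut p) :
  let F := triple u u^-1 v in
  (F (ordS (Ordinal p_gt0)))^-1 * F (Ordinal p_gt0) = u * u.
Proof. by rewrite /= /triple /= modn_small ?invgK//; lia. Qed.

Lemma fixes_xy2 : fixes ([~ x, y] * [~ x, y]) 1.
Proof.
rewrite gs_yE commutator_level1 level1M => -[|s [|//]] _ //.
by rewrite level1E !tree_aut_root.
Qed.

(** The section of the square below the first letter is x ^+ 4, which moves the
first letter because p does not divide 4. *)
Lemma not_fixes_xy2 : ~ fixes ([~ x, y] * [~ x, y]) 2.
Proof.
rewrite gs_yE commutator_level1 level1M.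
move=> /(_ [:: Ordinal p_gt0; Ordinal p_gt0] isT).
rewrite level1E triple_first.
have -> : x * x * (x * x) = x ^+ 4 by rewrite -mulgA.
rewrite gs_xXE => /(congr1 (map (@nat_of_ord p))).
rewrite !map_cons iter_ordS_val => -[].
have [p3|p3] := eqVneq p 3; first by rewrite /= [X in _ %% X]p3.
by rewrite modn_small /=; lia.
Qed.

(** The section below the first letter is deep_x n ^+ (2 * p), that is the
square of the commutator of x and y pushed down n + 2 levels. *)
Lemma depth_deep_commutator n : depths ([~ x, deep_y n] ^+ p) n.+3.
Proof.
rewrite commutator_level1 level1X; set F := fun s : 'I_p => _.
have F0 : F (Ordinal p_gt0) = iter n.+2 (@diag p) ([~ x, y] * [~ x, y]).
  have iterM k g h :
      iter k (@diag p) g * iter k (@diag p) h = iter k (@diag p) (g * h).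
    by elim: k => // k IHk; rewrite !iterS /diag level1M IHk.
  rewrite /F triple_first expgMn; last exact: commute_refl.
  by rewrite /deep_x twisted_xXp ?(ltnW p_gt2)// -iterM.
have below m :
    fixes_below (level1 F) (Ordinal p_gt0) m <-> fixes (F (Ordinal p_gt0)) m.
  split=> fix_m v sv; last by rewrite level1E fix_m.
  by have := fix_m v sv; rewrite level1E => -[].
exists (Ordinal p_gt0); split.
  apply/below; rewrite F0.
  have := fixes_diag ([~ x, y] * [~ x, y]) n.+2 1 p_gt0.
  by rewrite addn1 => /iffRL; apply; apply: fixes_xy2.
move=> /below; rewrite F0.
have := fixes_diag ([~ x, y] * [~ x, y]) n.+2 2 p_gt0.
by rewrite addn2 => /iffLR fix_2 /fix_2; apply: not_fixes_xy2.
Qed.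

End Pairs.

Theorem theorem1p1 (p : nat) (p_prime : prime p) (p_ge3 : 3 <= p) :
  infinite_set (@nielsen_classes (tree_aut p) 2 (@gupta_sidki p)).
Proof.
have p_neq4 : p != 4 by apply: contraTneq p_prime => ->.
move=> fin.
pose D (C : set ('I_2 -> tree_aut p)) : set nat :=
  \bigcup_(g in C) depths ([~ g ord0, g ord_max] ^+ p).
pose g n (i : 'I_2) := if i == ord0 then gs_x p else deep_y p n.
have finD C : nielsen_classes (@gupta_sidki p) C -> finite_set (D C).
  case=> h _ <-.
  apply: (@sub_finite_set _ _ (depths ([~ h ord0, h ord_max] ^+ p))).
    by move=> m [h' /nielsen_class_commutator/depths_conj_pm]; apply.
  exact: finite_depths.
apply: infinite_nat.
have finB := finite_preimage (in2W (@addIn 3)) (bigcup_finite fin finD).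
apply: sub_finite_set finB => n _; exists (nielsen_class (g n)); last first.
  exists (g n); last by rewrite addn3; apply: depth_deep_commutator.
  exists (@GroupAut (free_group 2) id id (fun _ _ => erefl) (fun=> erefl)
    (fun=> erefl)) => //.
  by apply/funext => i; rewrite /nielsen_act free_lift_gen.
exists (g n) => //.
rewrite /generating_tuples /= -(x_deep_y_generate p_ge3 p_neq4 n).
apply/seteqP; split; apply: generated_min; try exact: generated_subgroup.
  move=> _ [i _ <-]; rewrite /g.
  by case: ifP => _; apply: sub_generated; [left|right].
by move=> _ [->|->]; apply: sub_generated; [exists ord0|exists ord_max].
Qed.
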